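(* Let $P$ be a $d$-SMP of cardinality $k$. Then recognizing avoidability of $P$ is an $O(d\cdot k)$ problem; that is, given the $d\times k$ matrix $T(P)$, one can decide whether $P$ is avoidable in $O(d\cdot k)$ elementary operations (comparisons of entries).
   Context: A $d$-dimensional permutation $\Pi$ of length $n\ge 1$ is an ordered $(d-1)$-tuple $(\pi^2,\dots,\pi^d)$ of permutations of $\{1,\dots,n\}$, with $\pi^i=\pi^i_1\cdots\pi^i_n$; set $\pi^1=12\cdots n$. Its elements are the $d$-tuples $\Pi_j=(\pi^1_j,\pi^2_j,\dots,\pi^d_j)^T$, $1\le j\le n$. A $d$-dimensional singleton mesh pattern ($d$-SMP) $P$ is a set of $d$-tuples in $\{+,-\}^d$. Its elements are the columns of the matrix $T(P)$; its cardinality is $|P|$. For $i\ne j$, $\mathrm{sign}(\Pi_j-\Pi_i)\in\{+,-\}^d$ denotes the tuple of componentwise signs. The element $\Pi_i$ is an occurrence of $P$ if there is no $j\neq i$ with $\mathrm{sign}(\Pi_j-\Pi_i)\in P$. $\Pi$ avoids $P$ if no element of $\Pi$ is an occurrence of $P$. $P$ is avoidable if there exist arbitrarily long $d$-dimensional permutations avoiding $P$. *)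

(* Defs.v *)
From mathcomp Require Import all_boot all_fingroup all_algebra.

Set Implicit Arguments.
Unset Strict Implicit.
Unset Printing Implicit Defensive.

(* The entry [c] of the tuple is the permutation pi^(c+2). The dimension [d]
   is meant to be positive. *)
Definition dperm (d n : nat) : predArgType := (d.-1).-tuple 'S_n.

(* The coordinate [c] of the element Pi_j; consing the identity supplies pi^1,
   and the default of [nth] is never reached when [0 < d]. Values are counted
   from 0 instead of 1. *)
Definition coordinate (d n : nat) (Pi : dperm d n) (c : 'I_d) (j : 'I_n) : 'I_n :=
  nth 1%g (1%g :: Pi) c j.

(* Signs are booleans, [true] standing for + and [false] for -. *)
Definition smp (d : nat) : predArgType := {set 'cV[bool]_d}.

(* sign(Pi_j - Pi_i). For j != i no coordinate of the difference vanishes. *)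
Definition sign_diff (d n : nat) (Pi : dperm d n) (i j : 'I_n) : 'cV[bool]_d :=
  (\col_(c < d) (coordinate Pi c i < coordinate Pi c j)%N)%R.

Definition occurrence (d n : nat) (P : smp d) (Pi : dperm d n) (i : 'I_n) : Prop :=
  ~ exists2 j : 'I_n, j != i & sign_diff Pi i j \in P.

Definition avoids (d n : nat) (P : smp d) (Pi : dperm d n) : Prop :=
  forall i : 'I_n, ~ occurrence P Pi i.

Definition avoidable (d : nat) (P : smp d) : Prop :=
  forall N : nat, exists2 n : nat, N < n & exists Pi : dperm d n, avoids P Pi.

(* [T] is a matrix T(P): its columns are the elements of [P], each listed once,
   in an arbitrary order. *)
Definition matrix_of_smp (d k : nat) (P : smp d) (T : 'M[bool]_(d, k)) : Prop :=
  injective (fun j : 'I_k => col j T) /\ P = [set col j T | j : 'I_k].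

(* A register machine with read-only random access to a matrix of signs. The
   registers hold natural numbers, which can only be reset, incremented and
   compared; the entries of the matrix can only be compared with each other.
   Each executed instruction is one elementary operation. *)

Definition register := nat.
Definition label := nat.

Inductive instruction :=
| Reset of register
| Incr of register
| JumpLt of register & register & label
| JumpEqEntry of register & register & register & register & label
| Return of bool.

Definition program := seq instruction.

Inductive config :=
| Running of label & (register -> nat)
| Halted of bool.

Definition entry (d k : nat) (T : 'M[bool]_(d, k)) (i j : nat) : option bool :=
  if (insub i : option 'I_d) is Some i' then
    if (insub j : option 'I_k) is Some j' then Some (T i' j') else None
  else None.

Definition update (R : register -> nat) (x : register) (v : nat) : register -> nat :=
  fun y => if y == x then v else R y.

(* Executing a missing instruction, or accessing an entry outside the matrix,
   leaves the configuration unchanged, so that the machine never halts. *)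
Definition step (d k : nat) (p : program) (T : 'M[bool]_(d, k)) (c : config) : config :=
  if c is Running l R then
    match onth p l with
    | Some (Reset x) => Running l.+1 (update R x 0)
    | Some (Incr x) => Running l.+1 (update R x (R x).+1)
    | Some (JumpLt x y l') => Running (if R x < R y then l' else l.+1) R
    | Some (JumpEqEntry x y x' y' l') =>
        match entry T (R x) (R y), entry T (R x') (R y') with
        | Some a, Some b => Running (if a == b then l' else l.+1) R
        | _, _ => c
        end
    | Some (Return b) => Halted b
    | None => c
    end
  else c.

(* Register 0 initially holds [d], register 1 holds [k], the others hold 0. *)
Definition start (d k : nat) : config :=
  Running 0 (nth 0 [:: d; k]).

Definition returns_in (d k : nat) (p : program) (T : 'M[bool]_(d, k)) (t : nat)
    (b : bool) : Prop :=
  iter t (step p T) (start d k) = Halted b.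

(* Main.v *)
Require Import Defs.
From mathcomp Require Import all_boot all_fingroup all_algebra.
From mathcomp Require Import zify.

(** A pattern [P] is avoidable exactly when every row of its matrix contains
    both signs ([avoidableP]), and a matrix of signs can be tested for this
    property by comparing each entry with the first entry of its row.

    If the sign [b] is missing from row [c], then the element of a permutation
    that is extremal along the coordinate [c] in the direction opposite to [b]
    would need a witness beyond it, so it is an occurrence of [P].

    Conversely, suppose that all rows contain both signs, and list the elements
    of [P] as a word, prolonged by repeating one of them until it is as long as
    desired. We look for points, arranged in a cycle, such that the step from
    each point to the next one has the sign vector prescribed by the word: no
    point is then an occurrence. The coordinates can be treated separately, and
    each of them asks for a cyclic arrangement of distinct numbers with
    prescribed ascents and descents, not all of the same kind
    ([cyclic_word_perm]). With [A] ascents and [B] descents, going up by [B] at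
    each ascent and down by [A] at each descent closes the cycle; ties between
    non-adjacent positions are broken arbitrarily ([linear_extension]).

    The program runs through each row until it meets an entry that differs from
    the first one; it fails as soon as a row ends without such an entry. It
    spends a bounded number of instructions per entry and per row. *)

Set Implicit Arguments.
Unset Strict Implicit.
Unset Printing Implicit Defensive.

(** * Cyclic arrangements with prescribed ascents *)

(** The permutation sends [i] to its rank for the injective refinement
    [f i * n + i] of [f]. *)
Lemma linear_extension n (f : 'I_n -> nat) :
  exists s : 'S_n, forall i j, f i < f j -> s i < s j.
Proof.
pose g (i : 'I_n) := f i * n + i.
have g_inj : injective g.
  move=> i j /(congr1 (modn^~ n)); rewrite !modnMDl !modn_small //.
  exact: val_inj.
pose r i := #|[set x | g x < g i]|.
have r_mono i j : g i < g j -> r i < r j.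
  move=> lt_ij; apply/proper_card/properP; split.
    by apply/subsetP=> x; rewrite !inE => /ltn_trans; apply.
  by exists i; rewrite !inE // ltnn.
have r_lt i : r i < n.
  rewrite -[n in _ < n]card_ord -cardsT; apply/proper_card/properP.
  by split; [apply: subsetT | exists i; rewrite !inE // ltnn].
have r_inj : injective (fun i => Ordinal (r_lt i)).
  move=> i j [r_ij]; apply: g_inj.
  by case: (ltngtP (g i) (g j)) => // /r_mono; rewrite r_ij ltnn.
exists (perm r_inj) => i j lt_ij; rewrite !permE /=; apply: r_mono.
by rewrite /g; have := ltn_ord i; nia.
Qed.

Section Height.

Variables (n : nat) (s : 'I_n -> bool).

Definition ascents_before (j : nat) := #|[set i : 'I_n | s i & i < j]|.
Definition descents_from (j : nat) := #|[set i : 'I_n | ~~ s i & j <= i]|.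

(** Counting the descents that are still to come, instead of subtracting those
    already made, keeps the altitude of the closed walk in [nat]. *)
Definition height (j : nat) :=
  descents_from 0 * ascents_before j + ascents_before n * descents_from j.

Lemma ascents_beforeS (i : 'I_n) :
  ascents_before i.+1 = s i + ascents_before i.
Proof.
rewrite /ascents_before (cardsD1 i) !inE ltnSn andbT; congr (_ + _).
apply: eq_card => x; rewrite !inE -val_eqE /=.
by case: (s x); rewrite ?andbF //=; lia.
Qed.

Lemma descents_fromS (i : 'I_n) :
  descents_from i = ~~ s i + descents_from i.+1.
Proof.
rewrite /descents_from (cardsD1 i) !inE leqnn andbT; congr (_ + _).
apply: eq_card => x; rewrite !inE -val_eqE /=.
by case: (s x); rewrite ?andbF //=; lia.
Qed.

Lemma height_cycle : height n = height 0.
Proof.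
have a0 : ascents_before 0 = 0.
  by apply: eq_card0 => x; rewrite !inE ltn0 andbF.
have dn : descents_from n = 0.
  by apply: eq_card0 => x; rewrite !inE leqNgt ltn_ord andbF.
by rewrite /height a0 dn !muln0 addn0 mulnC.
Qed.

Lemma height_ordS (i : 'I_n) : height (ordS i) = height i.+1.
Proof.
rewrite /=; have [/modn_small-> // | le_n] := ltnP i.+1 n.
have -> : i.+1 = n by have := ltn_ord i; lia.
by rewrite modnn height_cycle.
Qed.

End Height.

(** Both signs must occur for the heights to be strictly monotone along the
    word: a descent goes down by the number of ascents, and vice versa. *)
Lemma cyclic_word_perm n (s : 'I_n -> bool) :
  (forall b, exists i, s i = b) ->
  exists sigma : 'S_n, forall i, (sigma i < sigma (ordS i)) = s i.
Proof.
move=> s_both; have [sigma sigmaP] := linear_extension (fun i : 'I_n => height s i).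
exists sigma => i.
have a_gt0 : 0 < ascents_before s n.
  by have [x sx] := s_both true; apply/card_gt0P; exists x; rewrite !inE sx /=.
have d_gt0 : 0 < descents_from s 0.
  by have [x sx] := s_both false; apply/card_gt0P; exists x; rewrite !inE sx.
have aS := ascents_beforeS s i; have dS := descents_fromS s i.
case si: (s i) aS dS => /= aS dS.
  by apply: sigmaP; rewrite height_ordS /height aS dS; nia.
apply/negbTE; rewrite -leqNgt; apply/ltnW/sigmaP.
by rewrite height_ordS /height aS dS; nia.
Qed.

(** * Avoidable patterns *)

(** Only the relative order of the elements along each coordinate matters, so
    the points may be indexed in any order: sorting them along the first
    coordinate turns that coordinate into the identity. *)
Lemma dperm_of_perms d n (sigma : 'I_d -> 'S_n) : 0 < d ->
  exists Pi : dperm d n, exists tau : 'S_n,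
    forall c x, coordinate Pi c (tau x) = sigma c x.
Proof.
case: d sigma => // d sigma _; pose tau := sigma ord0.
pose Pi : dperm d.+1 n := [tuple (tau^-1 * sigma (lift ord0 c))%g | c < d].
exists Pi, tau => c x; rewrite /coordinate.
case: (unliftP ord0 c) => [c' -> | -> /=]; last by rewrite perm1.
rewrite lift0 /= -[nth _ _ _](tnth_nth 1%g Pi) tnth_mktuple.
by rewrite permM permK.
Qed.

Lemma ordS_neq n (i : 'I_n) : 1 < n -> ordS i != i.
Proof.
move=> n_gt1; rewrite -val_eqE /=; have lt_i := ltn_ord i.
have [/modn_small-> | ge_i] := ltnP i.+1 n; first by lia.
have -> : i.+1 = n by lia.
by rewrite modnn; lia.
Qed.

(** Take the minimum of [pi] to see only the sign +, its maximum to see only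
    the sign -. *)
Lemma extremal_witness_sign n (b : bool) (pi : 'S_n) : 0 < n ->
  exists i, forall j, j != i -> (pi i < pi j) = b.
Proof.
case: n pi => // n pi _; case: b.
- exists ((pi^-1)%g ord0) => j; rewrite permKV lt0n.
  by apply: contraNneq => pj0; rewrite -(permK pi j); apply/eqP; congr ((pi^-1)%g _); apply/val_inj.
- exists ((pi^-1)%g ord_max) => j _; rewrite permKV.
  by apply/negbTE; rewrite -leqNgt -ltnS ltn_ord.
Qed.

(** In the converse direction, the graph that sends each element to a witness
    against its being an occurrence is a single cycle, which allows every
    length above [#|P|]. *)
Lemma avoidableP d (P : smp d) : 0 < d ->
  avoidable P <-> forall (c : 'I_d) (b : bool), exists2 v, v \in P & v c 0%R = b.
Proof.
move=> d_gt0; split=> [avP c b | both N].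
  have [n n_gt0 [Pi avPi]] := avP 0.
  have [i i_ext] := extremal_witness_sign b (nth 1%g (1%g :: Pi) c) n_gt0.
  have [/existsP[v /andP[vP /eqP vc]] | /existsPn noP] :=
    boolP [exists v, (v \in P) && (v c 0%R == b)]; first by exists v.
  case: (avPi i) => -[j ji sP].
  by have := noP (sign_diff Pi i j); rewrite sP mxE /coordinate i_ext ?eqxx.
pose n := #|P| + N.+1.
have [v0 v0P _] := both (Ordinal d_gt0) true.
(* The default value is reached on purpose: it fills the word up to length
   [n]. *)
pose w (i : 'I_n) : 'cV[bool]_d := nth v0 (enum P) i.
have wP i : w i \in P.
  rewrite -mem_enum /w; have [lt_i | ge_i] := ltnP i (size (enum P)).
    exact: mem_nth.
  by rewrite nth_default // mem_enum.
have w_both c b : exists i, w i c 0%R = b.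
  have [v vP <-] := both c b.
  have lt_v : index v (enum P) < n.
    by apply: ltn_addr; rewrite cardE index_mem mem_enum.
  by exists (Ordinal lt_v); rewrite /w nth_index ?mem_enum.
have n_gt1 : 1 < n by rewrite /n (cardD1 v0) v0P; lia.
have [sigma sigmaP] := fin_all_exists (fun c => cyclic_word_perm (w_both c)).
have [Pi [tau PiE]] := dperm_of_perms sigma d_gt0.
exists n; first exact: leq_addl.
exists Pi => i; case; exists (tau (ordS ((tau^-1)%g i))).
  by rewrite -[i in _ != i](permKV tau) (inj_eq perm_inj) ordS_neq.
rewrite -[i in sign_diff _ i](permKV tau); set x := (tau^-1)%g i.
suff -> : sign_diff Pi (tau x) (tau (ordS x)) = w x by [].
by apply/colP=> c; rewrite mxE !PiE sigmaP.
Qed.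

(** * The row-scanning program *)

(** Register 2 holds the current row and register 3 the current column;
    register 4 always holds 0, so that [JumpLt 4 1] is an unconditional jump
    once the case of an empty matrix has been discarded. *)
Definition scan_rows : program :=
  [:: (* 0 *) JumpLt 4 1 2;
      (* 1 *) Return false;
      (* 2: next row *) JumpLt 2 0 4;
      (* 3 *) Return true;
      (* 4 *) Reset 3;
      (* 5: next entry *) JumpLt 3 1 7;
      (* 6 *) Return false;
      (* 7 *) JumpEqEntry 2 3 2 4 10;
      (* 8: the row contains both signs *) Incr 2;
      (* 9 *) JumpLt 4 1 2;
      (* 10 *) Incr 3;
      (* 11 *) JumpLt 4 1 5].

Definition at_row (d k i : nat) (R : register -> nat) :=
  [/\ R 0 = d, R 1 = k, R 2 = i & R 4 = 0].

Lemma entryE d k (T : 'M[bool]_(d, k)) (i : 'I_d) (j : 'I_k) :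
  entry T i j = Some (T i j).
Proof. by rewrite /entry !valK. Qed.

(** [m] is the number of entries of the row that remain to be read; each costs
    four instructions, and noticing the end of the row costs two. *)
Lemma scan_row d k (T : 'M[bool]_(d, k.+1)) (i : 'I_d) m R :
    at_row d k.+1 i R -> R 3 + m = k.+1 ->
  exists2 t, t <= 4 * m + 2 &
  if [exists j : 'I_k.+1, (R 3 <= j) && (T i j != T i ord0)]
  then exists2 R', at_row d k.+1 i.+1 R'
       & iter t (step scan_rows T) (Running 5 R) = Running 2 R'
  else iter t (step scan_rows T) (Running 5 R) = Halted false.
Proof.
elim: m R => [|m IHm] R [R0 R1 R2 R4] R3m.
  exists 2 => //; case: existsP => [[j /andP[le_j _]] | _].
    by have := ltn_ord j; lia.
  by rewrite /= R1 ifN //; lia.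
have lt3 : R 3 < k.+1 by lia.
pose j := Ordinal lt3.
have entry_j : entry T (R 2) (R 3) = Some (T i j) by rewrite R2 (entryE T i j).
have entry_0 : entry T (R 2) (R 4) = Some (T i ord0).
  by rewrite R2 R4 (entryE T i ord0).
have [Tij | Tij] := boolP (T i j == T i ord0).
  have [|/=|t le_t tP] := IHm (update R 3 (R 3).+1) => //; first by rewrite /update /=; lia.
  exists (t + 4); first by lia.
  rewrite iterD (_ : iter 4 _ _ = Running 5 (update R 3 (R 3).+1)); last first.
    by rewrite /= R1 lt3 /= entry_j entry_0 Tij /= /update /= R1 R4.
  suff <- : [exists j' : 'I_k.+1, ((R 3).+1 <= j') && (T i j' != T i ord0)] =
            [exists j' : 'I_k.+1, (R 3 <= j') && (T i j' != T i ord0)] by exact: tP.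
  apply: eq_existsb => j'; rewrite [R 3 <= j']leq_eqVlt.
  by have [/(@val_inj _ _ _ j j')<- | //] := eqVneq (R 3) j'; rewrite Tij !andbF.
exists 4; first by lia.
rewrite ifT; last by apply/existsP; exists j; rewrite leqnn.
exists (update R 2 (R 2).+1); first by split=> //=; rewrite /update /= R2.
by rewrite /= R1 lt3 /= entry_j entry_0 (negbTE Tij) /= /update /= R1 R4.
Qed.

(** [m] is the number of rows that remain to be scanned. The registers are
    tracked through [at_row] instead of an explicit function, because nothing
    useful can be said of register 3 after a row has been left early. *)
Lemma scan_remaining_rows d k (T : 'M[bool]_(d, k.+1)) m R i :
    at_row d k.+1 i R -> i + m = d ->
  exists2 t, t <= m * (4 * k.+1 + 4) + 2 &
  iter t (step scan_rows T) (Running 2 R) =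
    Halted [forall c : 'I_d, (i <= c) ==> [exists j, T c j != T c ord0]].
Proof.
elim: m R i => [|m IHm] R i [R0 R1 R2 R4] im.
  exists 2 => //; rewrite /= R2 R0 ifN /=; last by lia.
  congr Halted; apply/esym/forallP => c; apply/implyP.
  by have := ltn_ord c; lia.
have lt_i : i < d by lia.
pose c := Ordinal lt_i.
have [||t1 le_t1] := scan_row T (i := c) (m := k.+1) (R := update R 3 0) => //.
rewrite (eq_existsb (P2 := fun j => T c j != T c ord0)) // => t1P.
have iter2 : iter 2 (step scan_rows T) (Running 2 R) = Running 5 (update R 3 0).
  by rewrite /= R2 R0 lt_i.
case: ifP t1P => [c_both [R' R'P t1P] | c_const t1P].
  have [|t2 le_t2 t2P] := IHm R' i.+1 R'P; first by lia.
  exists (t2 + (t1 + 2)); first by lia.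
  rewrite !iterD iter2 t1P t2P; congr Halted; apply: eq_forallb => c'.
  rewrite [i <= c']leq_eqVlt.
  by have [/(@val_inj _ _ _ c c')<- | //] := eqVneq i c'; rewrite c_both !implybT.
exists (t1 + 2); first by lia.
rewrite iterD iter2 t1P; congr Halted; apply/esym/forallPn; exists c.
by rewrite leqnn c_const.
Qed.

(** Comparing with the first entry of the row is enough: if all entries agree
    with it then the row has one sign only. *)
Lemma rows_bothP d k (P : smp d) (T : 'M[bool]_(d, k.+1)) :
    0 < d -> matrix_of_smp P T ->
  [forall c : 'I_d, [exists j, T c j != T c ord0]] <-> avoidable P.
Proof.
move=> d_gt0 [_ PE]; rewrite avoidableP //; split=> [/forallP T_both c b | both].
  suff [j Tj] : exists j, T c j = b.
    by exists (col j T); [rewrite PE; apply: imset_f | rewrite mxE].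
  have /existsP[j Tj] := T_both c.
  have [<- | neq_b] := eqVneq (T c ord0) b; first by exists ord0.
  by exists j; move: Tj neq_b; case: (T c j) (T c ord0) b => [] [] [].
apply/forallP=> c; have [v] := both c (~~ T c ord0).
rewrite PE => /imsetP[j _ ->]; rewrite mxE => Tj.
by apply/existsP; exists j; rewrite Tj; case: (T c ord0).
Qed.

Theorem corollary7 :
  exists (p : program) (C : nat),
  forall (d k : nat) (P : smp d) (T : 'M[bool]_(d, k)),
    0 < d -> #|P| = k -> matrix_of_smp P T ->
    exists (t : nat) (b : bool),
      [/\ t <= C * maxn 1 (d * k), returns_in p T t b & b <-> avoidable P].
Proof.
(* A nonempty matrix takes at most [1 + (d * (4 * k + 4) + 2)] steps, and both [d] and
   1 are at most [d * k]; an empty one takes two steps. *)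
exists scan_rows, 11 => d [|k] P T d_gt0 cardP PT.
  exists 2, false; split=> //; first by rewrite muln0.
  split=> // /avoidableP both.
  have [v] := both d_gt0 (Ordinal d_gt0) true.
  by rewrite (cards0_eq cardP) inE.
have [||t le_t tP] := @scan_remaining_rows d k T d (nth 0 [:: d; k.+1]) 0 => //.
exists (t + 1), [forall c : 'I_d, [exists j, T c j != T c ord0]]; split.
- by rewrite /maxn; case: ltnP; nia.
- by rewrite /returns_in iterD tP.
- exact: rows_bothP.
Qed.
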